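(* There exists a universal constant $c>0$ with the following property. Let $H$ be a limit circle Hamburger Hamiltonian with lengths $(l_j)_{j=1}^\infty$ and angles $(\phi_j)_{j=1}^\infty$. Suppose $\psi\in\mathbb{R}$ and $\alpha,\omega\ge1$ are such that $$(l_j)_{j=1}^\infty\in\ell^{\frac1\alpha},\qquad\big(l_j\sin^2(\phi_j-\psi)\big)_{j=1}^\infty\in\ell^{\frac1\omega}.$$ Then $$\log|w_{H,22}(ir)|\ \le\ r^{\frac2{\alpha+\omega}}\cdot c(\alpha+\omega)\Big(\sum_{j=1}^\infty l_j^{\frac1\alpha}\Big)^{\frac{\alpha}{\alpha+\omega}}\Big(\sum_{j=1}^\infty\big(l_j\sin^2(\phi_j-\psi)\big)^{\frac1\omega}\Big)^{\frac{\omega}{\alpha+\omega}}$$ for all sufficiently large $r$.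
   Context: Limit circle Hamburger Hamiltonian: let $(l_j)_{j=1}^\infty$ be positive numbers (''lengths'') with $L:=\sum_{j=1}^\infty l_j<\infty$, and $(\phi_j)_{j=1}^\infty$ real numbers (''angles'') with $\phi_{j+1}-\phi_j\notin\pi\mathbb{Z}$ for all $j$. Put $x_0:=0$, $x_n:=\sum_{j=1}^n l_j$, $\xi_\phi:=(\cos\phi,\sin\phi)^\top$, and $H(t):=\xi_{\phi_j}\xi_{\phi_j}^\top$ for $x_{j-1}\le t<x_j$, $j\in\mathbb{N}$; this defines $H$ on $(0,L)$. Monodromy matrix: with $J=\begin{pmatrix}0&-1\\1&0\end{pmatrix}$, for $z\in\mathbb{C}$ let $W_H(t;z)$ be the solution of $\frac{d}{dt}W_H(t;z)J=zW_H(t;z)H(t)$ for a.e. $t\in(0,L)$, $W_H(0;z)=I$. It exists up to $t=L$, and $W_H(z):=W_H(L;z)=(w_{H,ij}(z))_{i,j=1}^2$. For $p>0$, $(u_j)\in\ell^p$ means $\sum_j|u_j|^p<\infty$. ''Universal'' means independent of $H$, $\psi$, $\alpha$ and $\omega$. *)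

(* Defs.v *)
From HB Require Import structures.
From mathcomp Require Export all_boot all_order all_algebra.
From mathcomp Require Export all_classical all_reals all_analysis.
From mathcomp Require Export complex.

Export Order.TTheory GRing.Theory Num.Theory.
Export numFieldNormedType.Exports.

Set Implicit Arguments.
Unset Strict Implicit.
Unset Printing Implicit Defensive.

Local Open Scope classical_set_scope.
Local Open Scope ring_scope.

Definition in_lp (R : realType) (p : R) (u : R^nat) : Prop :=
  cvgn (series (fun j => `|u j| `^ p)).

(* Sequences are indexed from 0: [l j] and [phi j] stand for l_(j+1) and
   phi_(j+1), and the node x_n is the sum of the first n lengths. *)
Definition node (R : realType) (l : R^nat) (n : nat) : R := \sum_(j < n) l j.

Definition total_length (R : realType) (l : R^nat) : R :=
  limn (series l).

Definition limit_circle_hamburger (R : realType) (l phi : R^nat) : Prop :=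
  [/\ forall j, 0 < l j,
      cvgn (series l) &
      forall (j : nat) (k : int), phi j.+1 - phi j <> pi * k%:~R].

Definition xi (R : realType) (a : R) : 'cV[R]_2 := \col_i [:: cos a; sin a]`_i.

(* For t in (0, L) there is exactly one j with x_j <= t < x_(j+1); outside
   [0, L) the value is irrelevant. *)
Definition hamburger (R : realType) (l phi : R^nat) (t : R) : 'M[R]_2 :=
  let j := xget 0%N [set j | node l j <= t < node l j.+1] in
  xi (phi j) *m (xi (phi j))^T.

Definition abs_continuous (R : realType) (a b : R) (f : R -> R) : Prop :=
  forall e : R, 0 < e -> exists2 d : R, 0 < d &
    forall (n : nat) (u v : 'I_n -> R),
      (forall i, a <= u i /\ u i <= v i /\ v i <= b) ->
      (forall i j, i != j -> v i <= u j \/ v j <= u i) ->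
      \sum_i (v i - u i) < d ->
      \sum_i `|f (v i) - f (u i)| < e.

(* R[i] carries no normed R-module structure, so absolute continuity and
   derivatives of complex matrix functions of a real variable are taken
   on the real and imaginary parts of the entries. *)
Definition abs_continuous_mx (R : realType) (a b : R) m n
    (A : R -> 'M[R[i]]_(m, n)) : Prop :=
  forall i j, abs_continuous a b (fun t => complex.Re (A t i j)) /\
              abs_continuous a b (fun t => complex.Im (A t i j)).

Definition is_derive_mx (R : realType) m n
    (A : R -> 'M[R[i]]_(m, n)) (t : R) (D : 'M[R[i]]_(m, n)) : Prop :=
  forall i j,
    is_derive t 1 (fun s => complex.Re (A s i j)) (complex.Re (D i j)) /\
    is_derive t 1 (fun s => complex.Im (A s i j)) (complex.Im (D i j)).

(* Rows (0, -1) and (1, 0). *)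
Definition Jmx (K : pzRingType) : 'M[K]_2 := delta_mx 1 0 - delta_mx 0 1.

(* W' J = z W H a.e. on (0, L), W(0) = I.  As usual for a Hamiltonian that is
   integrable up to L, a solution is an absolutely continuous function on
   [0, L]. *)
Definition fundamental_solution (R : realType) (L : R) (H : R -> 'M[R]_2)
    (z : R[i]) (W : R -> 'M[R[i]]_2) : Prop :=
  [/\ abs_continuous_mx 0 L W,
      {ae (@lebesgue_measure R), forall t, 0 < t < L ->
        is_derive_mx (fun s => W s *m Jmx R[i]) t
          (z *: (W t *m map_mx (real_complex R) (H t)))} &
      W 0 = 1%:M].

Definition monodromy_matrix (R : realType) (L : R) (H : R -> 'M[R]_2)
    (WH : R[i] -> 'M[R[i]]_2) : Prop :=
  forall z, exists2 W, fundamental_solution L H z W & WH z = W L.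

(* Main.v *)
Require Import Defs.
From mathcomp Require Import measurable_realfun ring lra.

Set Implicit Arguments.
Unset Strict Implicit.
Unset Printing Implicit Defensive.

Local Open Scope classical_set_scope.
Local Open Scope ring_scope.

(** On each interval between consecutive nodes the Hamiltonian is a constant
projection [xi xi^T], and [xi^T J xi = 0]. Hence the product of a row of
[W(t; z)] with [xi] is constant there, and the row changes by a rank one term
proportional to the length of the interval ([second_row_step]). Passing from
the almost everywhere equation to this exact formula uses that an absolutely
continuous function with almost everywhere constant derivative is affine
([abs_continuous_derive_cst]).

Measure the second row of [W(.; ir)] in the coordinates rotated by [psi], giving
the two coordinates the weights [lam] and [lam^-1], and put [T = lam^2]. Over
the [j]-th interval this norm grows at most by the factor
[1 + 2 r l_j / T + 2 r T l_j sin^2 (phi_j - psi)] ([weighted_norm_step]).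
Since [1 + x <= exp (a x^(1/a))] for [a >= 1], the product of these factors is
at most the exponential of
[alpha (2r/T)^(1/alpha) A + omega (2rT)^(1/omega) B], where [A] and [B] are the
two sums of the theorem ([prod_le_expR]), so that [|w_22(ir)|] is bounded by
[(T + T^-1 + 2)] times this exponential, for every [T > 0] ([normc_w22_le]).

The choice of [T] as a power of [r] times a power of [A / B] makes
[(r/T)^(1/alpha) A] and [(rT)^(1/omega) B] both equal to
[r^(2/(alpha+omega)) A^(alpha/(alpha+omega)) B^(omega/(alpha+omega))]
([powR_balance]). The factor [T + T^-1 + 2] is then at most affine in [r] and is
absorbed for large [r] ([near_affine_le_expR]). This needs [B > 0], which holds
because consecutive angles differ modulo [pi]. The constant [c = 3] works. *)

(** * Absolutely continuous functions *)

(** The derivative as a gauge estimate: the increment of [f] at [x] is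
linear up to [e * `|y - x|] on a whole neighbourhood of [x]. *)
Lemma is_derive_near (R : realType) (f : R -> R) (x c e : R) :
  is_derive x 1 f c -> 0 < e ->
  exists2 d, 0 < d &
    forall y, `|y - x| < d -> `|f y - f x - c * (y - x)| <= e * `|y - x|.
Proof.
move=> df e0.
have cf : h^-1 *: (f (h *: 1 + x) - f x) @[h --> 0^'] --> c.
  by have [dfx <-] := df; exact: dfx.
move/cvgrPdist_le : cf => /(_ e e0).
rewrite near_withinE => /nbhs_ballP[d /= d0 hd].
exists d => // y yx; have [->|yNx] := eqVneq y x.
  by rewrite !subrr mulr0 subrr normr0 mulr0.
have yx0 : y - x != 0 by rewrite subr_eq0.
have := hd (y - x); rewrite /ball /= sub0r normrN => /(_ yx yx0).
rewrite /GRing.scale /= mulr1 subrK => h.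
have -> : f y - f x - c * (y - x)
    = - ((c - (y - x)^-1 * (f y - f x)) * (y - x)) by field.
by rewrite normrN normrM ler_wpM2r.
Qed.

(** The only part of the fundamental theorem of calculus for absolutely
continuous functions that is needed. The exceptional null set (enlarged by the
end points) is covered by an open set [U] of small measure. Call [x] reachable
([P x]) when [f x - f a - c * (x - a)] is bounded by [e * (x - a)] plus the sum
of [`|f v - f u| + `|c| * (v - u)] over finitely many non-overlapping intervals
[[u, v]] in [[a, x]] whose total length is at most the measure of [U] below [x].
Every point [m] has a gauge such that reachability passes from a point just before
[m] to a point just after it: if [m] is exceptional, the interval between the
two lies in [U] and joins the family; otherwise the derivative at [m] controls
the increment. Taking a supremum, [b] is reachable, and absolute continuity
makes the sum over the family small. *)
Lemma abs_continuous_derive_cst (R : realType) (a b c : R) (f : R -> R) :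
  a <= b -> abs_continuous a b f ->
  {ae (@lebesgue_measure R), forall t, a < t < b -> is_derive t 1 f c} ->
  f b - f a = c * (b - a).
Proof.
move=> ab acf aef; apply/eqP; rewrite -subr_eq0 -normr_le0.
apply/ler_addgt0Pr => e0 e00; rewrite add0r.
pose K := b - a + 1 + `|c|.
have K0 : 0 < K by rewrite /K; have := normr_ge0 c; lra.
pose e := e0 / K.
have e_gt0 : 0 < e by rewrite divr_gt0.
suff : `|f b - f a - c * (b - a)| <= e * K by rewrite divfK ?gt_eqF.
have [d d0 hd] := acf e e_gt0.
pose d' := Num.min (d / 2) e.
have d'0 : 0 < d' by rewrite lt_min e_gt0 divr_gt0.
pose N := ~` [set t | a < t < b -> is_derive t 1 f c] `|` [set a] `|` [set b].
have neg1 (x : R) : (@lebesgue_measure R).-negligible [set x].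
  by exists [set x]; split => //; exact: lebesgue_measure_set1.
have negN : (@lebesgue_measure R).-negligible N.
  apply: negligibleU; last exact: neg1.
  by apply: negligibleU; [exact: aef|exact: neg1].
have [U [oU NU]] := outer_measure_open_le N d'0.
have /negligible_outer_measure -> := negN.
rewrite add0e => muU.
have mU : measurable (U : set (measurableTypeR R)) by exact: open_measurable.
pose g x := lebesgue_measure (U `&` [set` `]a, x]]).
have gfin x : (g x <= d'%:E)%E.
  apply: le_trans muU; apply: le_measure; rewrite ?inE//.
  exact: measurableI.
pose P x := exists n (u v : nat -> R),
  [/\ forall i, (i < n)%N -> a <= u i /\ u i <= v i /\ v i <= x,
      forall i j, (i < j < n)%N -> v i <= u j,
      ((\sum_(i < n) (v i - u i))%:E <= g x)%E &
      `|f x - f a - c * (x - a)| <=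
        e * (x - a) + \sum_(i < n) (`|f (v i) - f (u i)| + `|c| * (v i - u i))].
have step m : a <= m <= b -> exists2 dm, 0 < dm &
    forall x y, a <= x -> x <= m -> m <= y -> m - dm < x -> y < m + dm ->
      P x -> P y.
  move=> /andP[am mb].
  have [mN|mN] := pselect (N m).
    have /nbhs_ballP[dm /= dm0 hdm] : nbhs m U.
      by apply: open_nbhs_nbhs; split => //; exact: NU.
    exists dm => // x y ax xm my xdm ydm [n [u [v [uv vu sg hx]]]].
    exists n.+1, (fun i => if (i < n)%N then u i else x),
      (fun i => if (i < n)%N then v i else y).
    have xy := le_trans xm my.
    split.
    - move=> i; rewrite ltnS leq_eqVlt => /predU1P[->|ilt].
        by rewrite ltnn.
      by rewrite ilt; have [? [? ?]] := uv i ilt; split=> //; split=> //; lra.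
    - move=> i j /andP[ij]; rewrite ltnS leq_eqVlt => /predU1P[jn|jn].
        by rewrite -jn ij ltnn; apply: (uv i _).2.2; rewrite -jn.
      by rewrite jn (ltn_trans ij jn); apply: vu; rewrite ij jn.
    - rewrite big_ord_recr /= ltnn.
      rewrite (eq_bigr (fun i : 'I_n => v i - u i)); last first.
        by move=> i _; rewrite ltn_ord.
      have -> : g y = (g x + (y - x)%:E)%E.
        rewrite /g; have -> : U `&` [set` `]a, y]] =
            (U `&` [set` `]a, x]]) `|` [set` `]x, y]].
          apply/seteqP; split => t /=; rewrite !in_itv /=.
            move=> [Ut /andP[at_ ty]]; have [tx|xt] := leP t x.
              by left; rewrite at_.
            by right.
          move=> [[Ut /andP[at_ tx]]|/andP[xt ty]].
            by split => //; rewrite at_ (le_trans tx).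
          split; last by rewrite (le_lt_trans ax xt).
          apply: hdm; rewrite /ball /= ltr_norml; apply/andP; split; lra.
        rewrite measureU//.
        + rewrite [X in (_ + X)%E = _]lebesgue_measure_itv /= lte_fin.
          have [->|xyn] := eqVneq x y; first by rewrite ltxx subrr.
          by rewrite lt_neqAle xyn xy.
        + exact: measurableI.
        + apply/seteqP; split => t //=; rewrite !in_itv /=.
          move=> [[_ /andP[_ tx]] /andP[xt _]].
          by move: (le_lt_trans tx xt); rewrite ltxx.
      by rewrite EFinD leeD2r.
    - rewrite big_ord_recr /= ltnn.
      rewrite (eq_bigr (fun i : 'I_n =>
        `|f (v i) - f (u i)| + `|c| * (v i - u i))); last first.
        by move=> i _; rewrite ltn_ord.
      have h1 : `|f y - f a - c * (y - a)| <=
          `|f x - f a - c * (x - a)| + `|f y - f x| + `|c| * (y - x).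
        have -> : f y - f a - c * (y - a) =
            (f x - f a - c * (x - a)) + (f y - f x) - c * (y - x) by ring.
        rewrite (le_trans (ler_normB _ _))// normrM.
        rewrite (ger0_norm (_ : 0 <= y - x)) ?subr_ge0// lerD2r.
        exact: ler_normD.
      have h2 : e * (x - a) <= e * (y - a) by rewrite ler_pM2l// lerD2r.
      lra.
  have dm : is_derive m 1 f c.
    apply: contrapT => ndm; apply: mN; rewrite /N.
    have [->|ma] := eqVneq m a; first by left; right.
    have [->|mb'] := eqVneq m b; first by right.
    left; left => /= h; apply: ndm; apply: h.
    by rewrite !lt_neqAle eq_sym ma am mb' mb.
  have [dl dl0 hdl] := is_derive_near dm e_gt0.
  exists dl => // x y ax xm my xdm ydm [n [u [v [uv vu sg hx]]]].
  exists n, u, v; split => //.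
  - by move=> i /uv[? [? ?]]; split=> //; split=> //; lra.
  - apply: le_trans sg _; apply: le_measure;
      rewrite ?inE; try exact: measurableI.
    move=> t /= [Ut]; rewrite !in_itv /= => /andP[at_ tx]; split=> //.
    by rewrite at_; lra.
  - have h1 : `|f y - f m - c * (y - m)| <= e * (y - m).
      have /hdl : `|y - m| < dl by rewrite ger0_norm; lra.
      by rewrite (ger0_norm (_ : 0 <= y - m)) ?subr_ge0.
    have h2 : `|f x - f m - c * (x - m)| <= e * (m - x).
      have /hdl : `|x - m| < dl by rewrite ler0_norm; lra.
      by rewrite (ler0_norm (_ : x - m <= 0)) ?opprB// subr_le0.
    have h3 : `|f y - f a - c * (y - a)| <= `|f x - f a - c * (x - a)| +
        `|f y - f m - c * (y - m)| + `|f x - f m - c * (x - m)|.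
      have -> : f y - f a - c * (y - a) = (f x - f a - c * (x - a)) +
          (f y - f m - c * (y - m)) - (f x - f m - c * (x - m)) by ring.
      by rewrite (le_trans (ler_normB _ _))// lerD2r ler_normD.
    lra.
have Pa : P a.
  exists 0%N, (fun=> 0), (fun=> 0); split => //.
  - by rewrite [X in X%:E]big_ord0; exact: measure_ge0.
  - by rewrite big_ord0 !subrr !mulr0 subrr normr0 addr0.
have Pb : P b.
  pose S := [set x | a <= x <= b /\ P x].
  have Sa : S a by split=> //; rewrite lexx.
  have hS : has_sup S by split; [exists a | exists b => x [/andP[]]].
  pose m := sup S.
  have am : a <= m by apply: ub_le_sup => //; exact: hS.2.
  have mb : m <= b by apply: ge_sup; [exists a|move=> x [/andP[]]].
  have [|dm dm0 hdm] := step m; first by rewrite am.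
  have [x [/andP[ax xb] Px] mx] := sup_adherent dm0 hS.
  have xm : x <= m by apply: ub_le_sup; [exact: hS.2|split=> //; rewrite ax].
  have Pm y : m <= y -> y < m + dm -> P y by move=> my ym; exact: (hdm x y).
  have [->|bm] := eqVneq b m; first by apply: Pm => //; lra.
  have mb' : m < b by rewrite lt_neqAle eq_sym bm.
  pose y := Num.min b (m + dm / 2).
  have my : m < y by rewrite lt_min mb'; lra.
  have yb : y <= b by rewrite ge_min lexx.
  have ym : y < m + dm by rewrite gt_min; apply/orP; right; lra.
  suff : y <= m by rewrite leNgt my.
  apply: ub_le_sup; first exact: hS.2.
  by split; [rewrite yb andbT; lra|apply: Pm => //; exact: ltW].
have [n [u [v [uv vu sg hb]]]] := Pb.
apply: (le_trans hb).
have sd : \sum_(i < n) (v i - u i) <= d'.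
  by rewrite -lee_fin; exact: le_trans sg (gfin b).
have dd : d' < d by rewrite /d' gt_min; apply/orP; left; lra.
have de : d' <= e by rewrite /d' ge_min lexx orbT.
have := hd n (fun i => u i) (fun i => v i) _ _ (le_lt_trans sd dd).
rewrite big_split /= -mulr_sumr => hh.
have {}hh : \sum_(i < n) `|f (v i) - f (u i)| < e.
  apply: hh; first by move=> i; exact: uv.
  move=> i j ij; case: (ltngtP i j) => [h|h|h]; last first.
  - by move/eqP: ij; case; exact: ord_inj.
  - by right; apply: vu; rewrite h ltn_ord.
  - by left; apply: vu; rewrite h ltn_ord.
have : `|c| * (\sum_(i < n) (v i - u i)) <= `|c| * e.
  by rewrite ler_wpM2l// (le_trans sd).
rewrite /K; lra.
Qed.

Lemma abs_continuousD (R : realType) (a b : R) (f g : R -> R) :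
  abs_continuous a b f -> abs_continuous a b g ->
  abs_continuous a b (fun t => f t + g t).
Proof.
move=> hf hg e e0; have e20 : 0 < e / 2 by rewrite divr_gt0.
have [d1 d10 h1] := hf _ e20; have [d2 d20 h2] := hg _ e20.
exists (Num.min d1 d2) => [|n u v uv disj]; rewrite ?lt_min ?d10//.
move=> /andP[s1 s2]; have := h1 n u v uv disj s1; have := h2 n u v uv disj s2.
suff : \sum_i `|f (v i) + g (v i) - (f (u i) + g (u i))| <=
    \sum_i `|f (v i) - f (u i)| + \sum_i `|g (v i) - g (u i)| by lra.
rewrite -big_split /=; apply: ler_sum => i _.
by rewrite opprD addrACA ler_normD.
Qed.

Lemma abs_continuousZ (R : realType) (a b k : R) (f : R -> R) :
  abs_continuous a b f -> abs_continuous a b (fun t => k * f t).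
Proof.
move=> hf e e0; have k0 : 0 < `|k| + 1 by rewrite ltr_wpDl.
have [d d0 h] := hf _ (divr_gt0 e0 k0).
exists d => // n u v uv disj s.
have {h} := h n u v uv disj s; rewrite ltr_pdivlMr//; apply: le_lt_trans.
rewrite mulr_suml; apply: ler_sum => i _.
by rewrite -mulrBr normrM mulrC ler_wpM2l// lerDl.
Qed.

Lemma abs_continuousW (R : realType) (a b a' b' : R) (f : R -> R) :
  a <= a' -> b' <= b -> abs_continuous a b f -> abs_continuous a' b' f.
Proof.
move=> aa bb hf e e0; have [d d0 h] := hf e e0.
exists d => // n u v uv disj; apply: h => // i.
by have [? [? ?]] := uv i; split; [|split] => //; lra.
Qed.

Lemma abs_continuous_dist (R : realType) (a b : R) (f : R -> R) (e : R) :
  abs_continuous a b f -> 0 < e ->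
  exists2 d, 0 < d & forall x y, a <= x -> x <= y -> y <= b -> y - x < d ->
    `|f y - f x| < e.
Proof.
move=> hf e0; have [d d0 h] := hf e e0.
exists d => // x y ax xy yb yxd.
have := h 1%N (fun=> x) (fun=> y); rewrite !big_ord1; apply => //.
by move=> i j; rewrite !ord1.
Qed.

Lemma ae_impl (R : realType) (P Q : R -> Prop) : (forall t, P t -> Q t) ->
  {ae (@lebesgue_measure R), forall t, P t} ->
  {ae (@lebesgue_measure R), forall t, Q t}.
Proof. by move=> PQ; apply: negligibleS => t; apply: contra_not; exact: PQ. Qed.

(** * The second row of the fundamental solution *)

(** The second row [(u1 + i v1, u2 + i v2)] of a solution for the spectral
parameter [i r] on an interval where the Hamiltonian is the projection onto
[(c, s)]. Its component along [(c, s)] has derivative zero, hence is constant;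
the right-hand sides of the system are then constant and the row evolves
linearly in time. *)
Lemma canonical_system_segment (R : realType) (r c s a b : R)
    (u1 u2 v1 v2 : R -> R) :
  a <= b ->
  abs_continuous a b u1 -> abs_continuous a b u2 ->
  abs_continuous a b v1 -> abs_continuous a b v2 ->
  {ae (@lebesgue_measure R), forall t, a < t < b ->
    [/\ is_derive t 1 u1 (r * (c * v1 t + s * v2 t) * s),
        is_derive t 1 u2 (- (r * (c * v1 t + s * v2 t) * c)),
        is_derive t 1 v1 (- (r * (c * u1 t + s * u2 t) * s)) &
        is_derive t 1 v2 (r * (c * u1 t + s * u2 t) * c)]} ->
  [/\ u1 b = u1 a + r * (c * v1 a + s * v2 a) * s * (b - a),
      u2 b = u2 a - r * (c * v1 a + s * v2 a) * c * (b - a),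
      v1 b = v1 a - r * (c * u1 a + s * u2 a) * s * (b - a) &
      v2 b = v2 a + r * (c * u1 a + s * u2 a) * c * (b - a)].
Proof.
move=> ab acu1 acu2 acv1 acv2 ae_der.
pose comb (w1 w2 : R -> R) t := c * w1 t + s * w2 t.
have comb_cst w1 w2 k : abs_continuous a b w1 -> abs_continuous a b w2 ->
    {ae (@lebesgue_measure R), forall t, a < t < b ->
      is_derive t 1 w1 (k t * s) /\ is_derive t 1 w2 (- (k t * c))} ->
    forall t, a <= t <= b -> comb w1 w2 t = comb w1 w2 a.
  move=> ac1 ac2 aew t /andP[at_ tb]; apply/eqP; rewrite -subr_eq0; apply/eqP.
  rewrite (@abs_continuous_derive_cst _ a t 0) ?mul0r//.
    apply: (abs_continuousW (lexx a) tb).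
    by apply: abs_continuousD; exact: abs_continuousZ.
  apply: ae_impl aew => x hx /andP[ax xt].
  have [|d1 d2] := hx; first by rewrite ax (lt_le_trans xt).
  have -> : 0 = c *: (k x * s) + s *: (- (k x * c)) :> R.
    by rewrite /GRing.scale /=; ring.
  exact: (is_deriveD (is_deriveZ c d1) (is_deriveZ s d2)).
have Ucst : forall t, a <= t <= b -> comb u1 u2 t = comb u1 u2 a.
  apply: (comb_cst _ _ (fun t => r * comb v1 v2 t)) => //.
  by apply: ae_impl ae_der => t ht /ht[].
have Vcst : forall t, a <= t <= b -> comb v1 v2 t = comb v1 v2 a.
  apply: (comb_cst _ _ (fun t => - (r * comb u1 u2 t))) => //.
  by apply: ae_impl ae_der => t ht /ht[_ _]; rewrite !mulNr opprK.
have incr w k : abs_continuous a b w ->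
    {ae (@lebesgue_measure R), forall t, a < t < b -> is_derive t 1 w k} ->
    w b = w a + k * (b - a).
  move=> acw aew.
  by rewrite -(abs_continuous_derive_cst ab acw aew) addrC subrK.
split; [|rewrite -mulNr|rewrite -mulNr|]; apply: incr => //;
  apply: ae_impl ae_der => t ht abt; have [] := ht abt;
  have abt' : a <= t <= b by (case/andP: abt => /ltW -> /ltW ->).
- by move=> + _ _ _; rewrite -/(comb v1 v2 t) Vcst.
- by move=> _ + _ _; rewrite -/(comb v1 v2 t) Vcst.
- by move=> _ _ + _; rewrite -/(comb u1 u2 t) Ucst.
- by move=> _ _ _; rewrite -/(comb u1 u2 t) Ucst.
Qed.

Lemma node_series (R : realType) (l : R^nat) : node l = series l.
Proof. by apply/funext => n; rewrite /node /series /= big_mkord. Qed.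

Lemma nodeS (R : realType) (l : R^nat) n : node l n.+1 = node l n + l n.
Proof. by rewrite /node big_ord_recr. Qed.

Lemma ler_node (R : realType) (l : R^nat) : (forall j, 0 < l j) ->
  {homo node l : m n / (m <= n)%N >-> m <= n}.
Proof.
move=> l0; apply: (homo_leq lexx le_trans) => n.
by rewrite nodeS lerDl ltW.
Qed.

Lemma node_le_total_length (R : realType) (l : R^nat) n :
  (forall j, 0 < l j) -> cvgn (series l) -> node l n <= total_length l.
Proof.
move=> l0 cl; rewrite /total_length -node_series.
by apply: nondecreasing_cvgn_le; [exact: ler_node|rewrite node_series].
Qed.

Lemma hamburgerE (R : realType) (l phi : R^nat) (j : nat) (t : R) :
  (forall j, 0 < l j) -> node l j <= t < node l j.+1 ->
  hamburger l phi t = xi (phi j) *m (xi (phi j))^T.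
Proof.
move=> l0 tj; rewrite /hamburger.
rewrite (xget_unique _ (x := j))// => k /= /andP[kt tk].
case/andP: tj => jt tj; apply/eqP; rewrite eqn_leq.
apply/andP; split; rewrite leqNgt; apply/negP => h.
  by have := ler_node l0 h; lra.
by have := ler_node l0 h; lra.
Qed.

Lemma mulmx_J10 (K : pzRingType) (A : 'M[K]_2) : (A *m Jmx K) 1 0 = A 1 1.
Proof.
rewrite mxE !big_ord_recl big_ord0 /Jmx !mxE /= !subr0 mulr0 add0r addr0 mulr1.
by have -> : lift ord0 ord0 = 1 :> 'I_2 by exact: val_inj.
Qed.

Lemma mulmx_J11 (K : pzRingType) (A : 'M[K]_2) : (A *m Jmx K) 1 1 = - A 1 0.
Proof.
rewrite mxE !big_ord_recl big_ord0 /Jmx !mxE /= sub0r subrr mulr0 !addr0 mulrN1.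
by have -> : ord0 = 0 :> 'I_2 by exact: val_inj.
Qed.

(** The entries of the second row of [z A (xi xi^T)], the right-hand side of
the system. *)
Lemma second_row_derivE (R : realType) (z : R[i]) (A : 'M[R[i]]_2) (x : R)
    (k : 'I_2) :
  (z *: (A *m map_mx (real_complex R) (xi x *m (xi x)^T))) 1 k =
  z * ((A 1 0 * (cos x)%:C%C + A 1 1 * (sin x)%:C%C) *
       (if k == 0 then cos x else sin x)%:C%C).
Proof.
rewrite !mxE !big_ord_recl big_ord0 !mxE !big_ord_recl !big_ord0 !mxE /= !addr0.
have -> : lift ord0 ord0 = 1 :> 'I_2 by exact: val_inj.
have -> : [:: cos x; sin x]`_k = if k == 0 then cos x else sin x.
  by case: k => [[|[|]]].
by rewrite !rmorphM /= !mulrA -mulrDl mulrA.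
Qed.

(** One step of the row recursion: the effect on the second row of [W] of
the interval between consecutive nodes. *)
Lemma second_row_step (R : realType) (l phi : R^nat) (r : R)
    (W : R -> 'M[R[i]]_2) (j : nat) :
  (forall j, 0 < l j) -> cvgn (series l) ->
  fundamental_solution (total_length l) (hamburger l phi) (Complex 0 r) W ->
  let u1 t := complex.Re (W t 1 0) in let u2 t := complex.Re (W t 1 1) in
  let v1 t := complex.Im (W t 1 0) in let v2 t := complex.Im (W t 1 1) in
  let c := cos (phi j) in let s := sin (phi j) in
  let a := node l j in let b := node l j.+1 in
  [/\ u1 b = u1 a + r * (c * v1 a + s * v2 a) * s * l j,
      u2 b = u2 a - r * (c * v1 a + s * v2 a) * c * l j,
      v1 b = v1 a - r * (c * u1 a + s * u2 a) * s * l j &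
      v2 b = v2 a + r * (c * u1 a + s * u2 a) * c * l j].
Proof.
move=> l0 cl [acW deW _] u1 u2 v1 v2 c s a b.
have -> : l j = b - a by rewrite /a /b nodeS addrAC subrr add0r.
have a0 : 0 <= a by rewrite /a -(big_ord0 _ _ _ l : node l 0 = 0) ler_node.
have bL : b <= total_length l by exact: node_le_total_length.
apply: (@canonical_system_segment R r c s a b u1 u2 v1 v2).
- by rewrite ler_node.
- exact: (abs_continuousW a0 bL (acW 1 0).1).
- exact: (abs_continuousW a0 bL (acW 1 1).1).
- exact: (abs_continuousW a0 bL (acW 1 0).2).
- exact: (abs_continuousW a0 bL (acW 1 1).2).
apply: (ae_impl _ deW) => t dt /andP[at_ tb].
have tL : 0 < t < total_length l.
  by rewrite (le_lt_trans a0)//= (lt_le_trans tb).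
have {}dt := dt tL.
have HE : hamburger l phi t = xi (phi j) *m (xi (phi j))^T.
  by apply: hamburgerE => //; rewrite (ltW at_).
rewrite HE in dt.
have [dRe0 dIm0] := dt 1 0; have [dRe1 dIm1] := dt 1 1.
rewrite second_row_derivE /= -/c -/s in dRe0 dIm0.
rewrite second_row_derivE /= -/c -/s in dRe1 dIm1.
have e2 : (fun t => complex.Re ((W t *m Jmx R[i]) 1 0)) = u2.
  by apply/funext => x; rewrite mulmx_J10.
have f2 : (fun t => complex.Im ((W t *m Jmx R[i]) 1 0)) = v2.
  by apply/funext => x; rewrite mulmx_J10.
have e1 : - (fun t => complex.Re ((W t *m Jmx R[i]) 1 1)) = u1.
  apply/funext => x; rewrite /= fctE mulmx_J11 /u1.
  by case: (W x 1 0) => ? ? /=; rewrite opprK.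
have f1 : - (fun t => complex.Im ((W t *m Jmx R[i]) 1 1)) = v1.
  apply/funext => x; rewrite /= fctE mulmx_J11 /v1.
  by case: (W x 1 0) => ? ? /=; rewrite opprK.
rewrite e2 in dRe0; rewrite f2 in dIm0.
have {}dRe1 := is_deriveN dRe1; have {}dIm1 := is_deriveN dIm1.
rewrite e1 in dRe1; rewrite f1 in dIm1.
rewrite /u1 /u2 /v1 /v2 in dRe0 dRe1 dIm0 dIm1 *.
split.
- apply: is_derive_eq dRe1 _.
  by case: (W t 1 0) => ? ?; case: (W t 1 1) => ? ? /=; ring.
- apply: is_derive_eq dRe0 _.
  by case: (W t 1 0) => ? ?; case: (W t 1 1) => ? ? /=; ring.
- apply: is_derive_eq dIm1 _.
  by case: (W t 1 0) => ? ?; case: (W t 1 1) => ? ? /=; ring.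
- apply: is_derive_eq dIm0 _.
  by case: (W t 1 0) => ? ?; case: (W t 1 1) => ? ? /=; ring.
Qed.

(** * Growth of the weighted norm *)

(** The size of the row vector [(u1 + i v1, u2 + i v2)]: its coordinates along
[(cos psi, sin psi)] and [(- sin psi, cos psi)] are measured with the weights
[lam] and [lam^-1]. Moduli of complex numbers are replaced by sums of the
absolute values of real and imaginary parts, so that everything is real. *)
Definition weighted_norm (R : realType) (lam psi u1 u2 v1 v2 : R) : R :=
  lam * (`|u1 * cos psi + u2 * sin psi| + `|v1 * cos psi + v2 * sin psi|) +
  lam^-1 * (`|u2 * cos psi - u1 * sin psi| + `|v2 * cos psi - v1 * sin psi|).

(** The growth of the weighted norm over one interval. The increment of the row
is a rank one map applied to it; both the functional and the direction of this
map have weighted norm at most [lam * `|sin| + lam^-1 * `|cos|], the angle being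
[phi - psi], and the square of that is at most
[2 * (lam^-2 + lam^2 * sin^2)]. *)
Lemma weighted_norm_step (R : realType)
    (lam psi phi c s r l u1 u2 v1 v2 : R) :
  0 < lam -> 0 <= r -> 0 <= l -> c = cos phi -> s = sin phi ->
  weighted_norm lam psi
    (u1 + r * (c * v1 + s * v2) * s * l) (u2 - r * (c * v1 + s * v2) * c * l)
    (v1 - r * (c * u1 + s * u2) * s * l) (v2 + r * (c * u1 + s * u2) * c * l) <=
  weighted_norm lam psi u1 u2 v1 v2 *
    (1 + 2 * r * (l / lam ^+ 2) +
     2 * r * (lam ^+ 2 * (l * sin (phi - psi) ^+ 2))).
Proof.
move=> lam0 r0 l0 cphi sphi; rewrite /weighted_norm.
pose ct := cos (phi - psi); pose st := sin (phi - psi).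
have cE : ct = c * cos psi + s * sin psi by rewrite /ct cosB cphi sphi.
have sE : st = s * cos psi - c * sin psi by rewrite /st sinB cphi sphi.
have cs1 := cos2Dsin2 psi.
set pu := u1 * cos psi + u2 * sin psi; set pv := v1 * cos psi + v2 * sin psi.
set qu := u2 * cos psi - u1 * sin psi; set qv := v2 * cos psi - v1 * sin psi.
have rot w1 w2 : c * w1 + s * w2 =
    ct * (w1 * cos psi + w2 * sin psi) + st * (w2 * cos psi - w1 * sin psi).
  transitivity ((c * w1 + s * w2) * (cos psi ^+ 2 + sin psi ^+ 2)).
    by rewrite cs1 mulr1.
  by rewrite cE sE; ring.
rewrite !rot -/pu -/pv -/qu -/qv.
set U := ct * pu + st * qu; set V := ct * pv + st * qv.
have -> : (u1 + r * V * s * l) * cos psi + (u2 - r * V * c * l) * sin psi =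
    pu + (r * l) * (V * st) by rewrite /pu sE; ring.
have -> : (v1 - r * U * s * l) * cos psi + (v2 + r * U * c * l) * sin psi =
    pv - (r * l) * (U * st) by rewrite /pv sE; ring.
have -> : (u2 - r * V * c * l) * cos psi - (u1 + r * V * s * l) * sin psi =
    qu - (r * l) * (V * ct) by rewrite /qu cE; ring.
have -> : (v2 + r * U * c * l) * cos psi - (v1 - r * U * s * l) * sin psi =
    qv + (r * l) * (U * ct) by rewrite /qv cE; ring.
have rl0 : 0 <= r * l by rewrite mulr_ge0.
have bound x y z : `|x + r * l * (y * z)| <= `|x| + r * l * (`|y| * `|z|).
  by rewrite (le_trans (ler_normD _ _))// !normrM (ger0_norm r0) (ger0_norm l0).
have boundN x y z : `|x - r * l * (y * z)| <= `|x| + r * l * (`|y| * `|z|).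
  by rewrite (le_trans (ler_normB _ _))// !normrM (ger0_norm r0) (ger0_norm l0).
have hU : `|U| <= `|ct| * `|pu| + `|st| * `|qu|.
  by rewrite (le_trans (ler_normD _ _))// !normrM.
have hV : `|V| <= `|ct| * `|pv| + `|st| * `|qv|.
  by rewrite (le_trans (ler_normD _ _))// !normrM.
set X := `|pu| + `|pv|; set Y := `|qu| + `|qv|.
have X0 : 0 <= X by rewrite addr_ge0.
have Y0 : 0 <= Y by rewrite addr_ge0.
set C := `|ct|; set S := `|st|.
have C0 : 0 <= C by exact: normr_ge0.
have S0 : 0 <= S by exact: normr_ge0.
have C1 : C ^+ 2 <= 1.
  by rewrite /C real_normK ?num_real// -(cos2Dsin2 (phi - psi)) lerDl sqr_ge0.
have il0 : 0 < lam^-1 by rewrite invr_gt0.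
have UV : `|U| + `|V| <= C * X + S * Y.
  by rewrite /X /Y /C /S; move: hU hV; lra.
have key : (lam * S + lam^-1 * C) * (C * X + S * Y) <=
    (lam * S + lam^-1 * C) ^+ 2 * (lam * X + lam^-1 * Y).
  rewrite expr2 -[leRHS]mulrA ler_wpM2l//.
    by rewrite addr_ge0// mulr_ge0// ltW.
  have -> : (lam * S + lam^-1 * C) * (lam * X + lam^-1 * Y) =
    C * X + S * Y + (lam ^+ 2 * (S * X) + lam^-1 ^+ 2 * (C * Y)).
    by field; rewrite gt_eqF.
  by rewrite lerDl addr_ge0// mulr_ge0 ?sqr_ge0// mulr_ge0.
have sq : (lam * S + lam^-1 * C) ^+ 2 <=
    2 * (lam ^+ 2)^-1 + 2 * (lam ^+ 2 * st ^+ 2).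
  have -> : st ^+ 2 = S ^+ 2 by rewrite /S real_normK ?num_real.
  have h : lam^-1 ^+ 2 * C ^+ 2 <= (lam ^+ 2)^-1.
    by rewrite exprVn ler_piMr// invr_ge0 sqr_ge0.
  have := sqr_ge0 (lam * S - lam^-1 * C); rewrite sqrrB sqrrD !exprMn; lra.
have N0 : 0 <= lam * X + lam^-1 * Y by rewrite addr_ge0// mulr_ge0// ltW.
apply: (@le_trans _ _ (lam * (X + r * l * ((`|U| + `|V|) * S)) +
    lam^-1 * (Y + r * l * ((`|U| + `|V|) * C)))).
  apply: lerD; rewrite ler_pM2l//.
    by have := bound pu V st; have := boundN pv U st; rewrite /X /S; lra.
  by have := boundN qu V ct; have := bound qv U ct; rewrite /Y /C; lra.
apply: (@le_trans _ _ (lam * X + lam^-1 * Y +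
    r * l * ((lam * S + lam^-1 * C) * (C * X + S * Y)))).
  have : r * l * ((lam * S + lam^-1 * C) * (`|U| + `|V|)) <=
      r * l * ((lam * S + lam^-1 * C) * (C * X + S * Y)).
    by rewrite ler_wpM2l// ler_wpM2l// addr_ge0// mulr_ge0// ltW.
  by lra.
have : r * l * ((lam * S + lam^-1 * C) * (C * X + S * Y)) <=
    r * l * ((2 * (lam ^+ 2)^-1 + 2 * (lam ^+ 2 * st ^+ 2)) *
      (lam * X + lam^-1 * Y)).
  by rewrite ler_wpM2l// (le_trans key)// ler_wpM2r.
rewrite -/st; lra.
Qed.

Lemma weighted_norm_ge (R : realType) (lam psi u1 u2 v1 v2 : R) : 0 < lam ->
  `|u2| + `|v2| <= (lam + lam^-1) * weighted_norm lam psi u1 u2 v1 v2.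
Proof.
move=> lam0; rewrite /weighted_norm.
have rot w1 w2 : `|w2| <= `|w1 * cos psi + w2 * sin psi| +
    `|w2 * cos psi - w1 * sin psi|.
  have {1}-> : w2 = (w1 * cos psi + w2 * sin psi) * sin psi +
      (w2 * cos psi - w1 * sin psi) * cos psi.
    by rewrite -[LHS]mulr1 -(cos2Dsin2 psi); ring.
  rewrite (le_trans (ler_normD _ _))// !normrM lerD// ler_piMr//.
    exact: sin_max.
  exact: cos_max.
move: (rot u1 u2) (rot v1 v2).
set X := `|_| in rot *; set a := `|_ + _|; set b := `|_ - _|.
set c := `|_ + _|; set d := `|_ - _| => h1 h2.
have -> : (lam + lam^-1) * (lam * (a + c) + lam^-1 * (b + d)) =
    (a + c) + (b + d) + (lam ^+ 2 * (a + c) + lam^-1 ^+ 2 * (b + d)).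
  by field; rewrite gt_eqF.
have : 0 <= lam ^+ 2 * (a + c) + lam^-1 ^+ 2 * (b + d).
  by apply: addr_ge0; apply: mulr_ge0; rewrite ?sqr_ge0//;
    apply: addr_ge0; exact: normr_ge0.
by lra.
Qed.

Lemma weighted_norm0 (R : realType) (lam psi : R) : 0 < lam ->
  weighted_norm lam psi 0 1 0 0 <= lam + lam^-1.
Proof.
move=> lam0; rewrite /weighted_norm.
rewrite !mul0r !mul1r !add0r !subr0 oppr0 normr0 !addr0.
have il0 : 0 < lam^-1 by rewrite invr_gt0.
by apply: lerD; (apply: ler_piMr; [exact: ltW|]);
  [exact: sin_max|exact: cos_max].
Qed.

Lemma weighted_norm_node (R : realType) (l phi : R^nat) (r lam psi : R)
    (W : R -> 'M[R[i]]_2) (n : nat) :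
  0 <= r -> 0 < lam -> (forall j, 0 < l j) -> cvgn (series l) ->
  fundamental_solution (total_length l) (hamburger l phi) (Complex 0 r) W ->
  weighted_norm lam psi
    (complex.Re (W (node l n) 1 0)) (complex.Re (W (node l n) 1 1))
    (complex.Im (W (node l n) 1 0)) (complex.Im (W (node l n) 1 1)) <=
  (lam + lam^-1) *
    \prod_(j < n) (1 + 2 * r * (l j / lam ^+ 2) +
                   2 * r * (lam ^+ 2 * (l j * sin (phi j - psi) ^+ 2))).
Proof.
move=> r0 lam0 l0 cl fW; elim: n => [|n ih].
  have [_ _ W0] := fW.
  by rewrite /node !big_ord0 W0 !mxE /= mulr1; exact: weighted_norm0.
rewrite big_ord_recr /= mulrA.
have [-> -> -> ->] := second_row_step n l0 cl fW.
apply: le_trans (weighted_norm_step _ _ _ _ _ lam0 r0 (ltW (l0 n))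
  (erefl (cos (phi n))) (erefl (sin (phi n)))) _.
have ln0 := ltW (l0 n).
have x0 : 0 <= l n / lam ^+ 2 by rewrite divr_ge0 ?sqr_ge0.
have y0 : 0 <= lam ^+ 2 * (l n * sin (phi n - psi) ^+ 2).
  by rewrite mulr_ge0 ?sqr_ge0// mulr_ge0 ?sqr_ge0.
by rewrite ler_wpM2r// !addr_ge0// mulr_ge0// mulr_ge0.
Qed.

(** * Bounding the product by an exponential *)

(** With [t = x `^ a^-1] this is
[1 + t `^ a <= (1 + t) `^ a <= expR (a * t)]. *)
Lemma ge1Dx_expR_powR (R : realType) (a x : R) : 1 <= a -> 0 <= x ->
  1 + x <= expR (a * x `^ a^-1).
Proof.
move=> a1 x0; have a0 : 0 < a by rewrite (lt_le_trans ltr01).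
set t := x `^ a^-1; have t0 : 0 <= t by exact: powR_ge0.
have xE : x = t `^ a by rewrite /t -powRrM mulVf ?gt_eqF// powRr1.
rewrite mulrC expRM xE.
apply: (@le_trans _ _ ((1 + t) `^ a)); last first.
  apply: ge0_ler_powR; rewrite ?nnegrE ?(ltW a0) ?expR_ge0 ?addr_ge0//.
  exact: expR_ge1Dx.
have s0 : 0 < 1 + t by rewrite ltr_pwDl.
have -> : (1 + t) `^ a = (1 + t) * (1 + t) `^ (a - 1).
  by rewrite mulr_powRB1// ltW.
have h1 : 1 <= (1 + t) `^ (a - 1).
  by rewrite -[leLHS](powRr0 (1 + t)) ler_powR ?lerDl// subr_ge0.
have h2 : t `^ (a - 1) <= (1 + t) `^ (a - 1).
  by apply: ge0_ler_powR; rewrite ?nnegrE ?subr_ge0// ?ltW// ltrDr ltr01.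
have h3 : t `^ a <= t * (1 + t) `^ (a - 1).
  by rewrite -mulr_powRB1// ler_wpM2l.
by rewrite mulrDl mul1r lerD.
Qed.

Lemma ler_sum_limn (R : realType) (u : R^nat) n :
  (forall j, 0 <= u j) -> cvgn (series u) ->
  \sum_(j < n) u j <= limn (series u).
Proof.
move=> u0 cu; rewrite -(big_mkord xpredT u).
apply: (nondecreasing_cvgn_le _ cu).
exact: (@nondecreasing_series _ u xpredT 0%N (fun n _ _ => u0 n)).
Qed.

Lemma prod_le_expR (R : realType) (x y : R^nat) (X Y alpha omega : R) (n : nat) :
  (forall j, 0 <= x j) -> (forall j, 0 <= y j) -> 1 <= alpha -> 1 <= omega ->
  0 <= X -> 0 <= Y ->
  cvgn (series (fun j => x j `^ alpha^-1)) ->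
  cvgn (series (fun j => y j `^ omega^-1)) ->
  \prod_(j < n) (1 + X * x j + Y * y j) <=
  expR (alpha * X `^ alpha^-1 * limn (series (fun j => x j `^ alpha^-1)) +
        omega * Y `^ omega^-1 * limn (series (fun j => y j `^ omega^-1))).
Proof.
move=> x0 y0 a1 o1 X0 Y0 cx cy.
have a0 : 0 < alpha by rewrite (lt_le_trans ltr01).
have o0 : 0 < omega by rewrite (lt_le_trans ltr01).
apply: (@le_trans _ _ (\prod_(j < n) expR (alpha * (X * x j) `^ alpha^-1 +
    omega * (Y * y j) `^ omega^-1))).
  apply: ler_prod => j _.
  have Xx0 : 0 <= X * x j by rewrite mulr_ge0.
  have Yy0 : 0 <= Y * y j by rewrite mulr_ge0.
  rewrite !addr_ge0//= expRD.
  apply: (@le_trans _ _ ((1 + X * x j) * (1 + Y * y j))).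
    by have := mulr_ge0 Xx0 Yy0; lra.
  by apply: ler_pM; rewrite ?addr_ge0//; exact: ge1Dx_expR_powR.
rewrite -expR_sum ler_expR big_split /=.
apply: lerD.
  under eq_bigr do rewrite powRM// mulrA.
  rewrite -mulr_sumr ler_wpM2l//; first by rewrite mulr_ge0 ?powR_ge0// ltW.
  apply: (ler_sum_limn (u := fun j => x j `^ alpha^-1)) => // j.
  exact: powR_ge0.
under eq_bigr do rewrite powRM// mulrA.
rewrite -mulr_sumr ler_wpM2l//; first by rewrite mulr_ge0 ?powR_ge0// ltW.
apply: (ler_sum_limn (u := fun j => y j `^ omega^-1)) => // j.
exact: powR_ge0.
Qed.

(** A bound along a sequence tending to the right end point passes to the
limit; absolute continuity is only used for continuity there. *)
Lemma abs_continuous_cvg_le (R : realType) (b M : R) (f g : R -> R) (x : R^nat) :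
  abs_continuous 0 b f -> abs_continuous 0 b g ->
  (forall n, 0 <= x n <= b) -> x n @[n --> \oo] --> b ->
  (forall n, `|f (x n)| + `|g (x n)| <= M) -> `|f b| + `|g b| <= M.
Proof.
move=> acf acg xb xcvg hM; apply/ler_addgt0Pr => e e0.
have e20 : 0 < e / 2 by rewrite divr_gt0.
have [d1 d10 h1] := abs_continuous_dist acf e20.
have [d2 d20 h2] := abs_continuous_dist acg e20.
have d0 : 0 < Num.min d1 d2 by rewrite lt_min d10.
move/cvgrPdist_lt : xcvg => /(_ _ d0) [n _ /(_ n (leqnn n))].
have /andP[x0 xnb] := xb n.
rewrite ger0_norm ?subr_ge0// lt_min => /andP[s1 s2].
have := h1 _ _ x0 xnb (lexx b) s1; have := h2 _ _ x0 xnb (lexx b) s2.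
have := ler_normD (f b - f (x n)) (f (x n)); rewrite subrK.
have := ler_normD (g b - g (x n)) (g (x n)); rewrite subrK.
by have := hM n; lra.
Qed.

Lemma normc_le (R : realType) (z : R[i]) :
  ComplexField.Normc.normc z <= `|complex.Re z| + `|complex.Im z|.
Proof.
case: z => x y /=; rewrite -[leRHS]ger0_norm ?addr_ge0// -sqrtr_sqr.
apply: ler_wsqrtr; rewrite sqrrD !real_normK ?num_real// mulr2n.
by have := mulr_ge0 (normr_ge0 x) (normr_ge0 y); lra.
Qed.

Lemma in_lp_cvgn (R : realType) (p : R) (u : R^nat) :
  (forall j, 0 <= u j) -> in_lp p u -> cvgn (series (fun j => u j `^ p)).
Proof.
move=> u0; rewrite /in_lp.
have -> : (fun j => `|u j| `^ p) = (fun j => u j `^ p).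
  by apply/funext => j; rewrite ger0_norm.
by [].
Qed.

(** The bound before optimisation: it holds for every weight [T], the square of
the weight [lam] of the norm. The factor [T + T^-1 + 2] is the price of passing
between the entry [w_22] and the weighted norm. *)
Lemma normc_w22_le (R : realType) (l phi : R^nat) (psi alpha omega r T : R)
    (W : R -> 'M[R[i]]_2) :
  limit_circle_hamburger l phi -> 1 <= alpha -> 1 <= omega ->
  in_lp alpha^-1 l -> in_lp omega^-1 (fun j => l j * sin (phi j - psi) ^+ 2) ->
  0 <= r -> 0 < T ->
  fundamental_solution (total_length l) (hamburger l phi) (Complex 0 r) W ->
  ComplexField.Normc.normc (W (total_length l) 1 1) <=
  (T + T^-1 + 2) *
  expR (alpha * (2 * r / T) `^ alpha^-1 *
          limn (series (fun j => l j `^ alpha^-1)) +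
        omega * (2 * r * T) `^ omega^-1 *
          limn (series (fun j => (l j * sin (phi j - psi) ^+ 2) `^ omega^-1))).
Proof.
move=> [l0 cl _] a1 o1 la lo r0 T0 fW.
apply: le_trans (normc_le _) _.
set M := (X in _ <= X).
have [acW _ _] := fW.
pose f t := complex.Re (W t 1 1); pose g t := complex.Im (W t 1 1).
rewrite -/(f (total_length l)) -/(g (total_length l)).
apply: (@abs_continuous_cvg_le _ _ _ f g (node l)).
- exact: (acW 1 1).1.
- exact: (acW 1 1).2.
- move=> n; rewrite node_le_total_length// andbT.
  by rewrite -(big_ord0 _ _ _ l : node l 0 = 0) ler_node.
- by rewrite node_series.
move=> n; pose lam := Num.sqrt T.
have lam0 : 0 < lam by rewrite sqrtr_gt0.
have lamT : lam ^+ 2 = T by rewrite sqr_sqrtr// ltW.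
have h1 := weighted_norm_ge psi (complex.Re (W (node l n) 1 0)) (f (node l n))
  (complex.Im (W (node l n) 1 0)) (g (node l n)) lam0.
apply: (le_trans h1).
have h2 := weighted_norm_node psi n r0 lam0 l0 cl fW.
have hl : 0 <= lam + lam^-1 by rewrite addr_ge0 ?invr_ge0 ?ltW.
apply: (le_trans (ler_wpM2l hl h2)).
rewrite mulrA /M.
have -> : (lam + lam^-1) * (lam + lam^-1) = T + T^-1 + 2.
  by rewrite -lamT; field; rewrite gt_eqF.
rewrite ler_wpM2l//.
  by rewrite !addr_ge0// ?invr_ge0 ltW.
rewrite lamT (eq_bigr (fun j : 'I_n => 1 + (2 * r / T) * l j +
  (2 * r * T) * (l j * sin (phi j - psi) ^+ 2))); last first.
  by move=> j _; congr (_ + _ + _); rewrite ?mulrA// mulrAC.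
apply: (prod_le_expR (x := l) (y := fun j => l j * sin (phi j - psi) ^+ 2)) => //.
- by move=> j; exact: ltW.
- by move=> j; rewrite mulr_ge0 ?sqr_ge0// ltW.
- by rewrite divr_ge0 ?mulr_ge0// ltW.
- by rewrite !mulr_ge0// ltW.
- by apply: in_lp_cvgn la => j; exact: ltW.
- by apply: in_lp_cvgn lo => j; rewrite mulr_ge0 ?sqr_ge0// ltW.
Qed.

(** The weight [T] for which the two terms of the exponent have equal size, and
their common value. *)
Lemma powR_balance (R : realType) (alpha omega r A B : R) :
  0 < alpha -> 0 < omega -> 0 < r -> 0 < A -> 0 < B ->
  let T := r `^ ((omega - alpha) / (alpha + omega)) *
           (A / B) `^ (alpha * omega / (alpha + omega)) in
  let Q := r `^ (2 / (alpha + omega)) *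
    (A `^ (alpha / (alpha + omega)) * B `^ (omega / (alpha + omega))) in
  (r / T) `^ alpha^-1 * A = Q /\ (r * T) `^ omega^-1 * B = Q.
Proof.
move=> a0 o0 r0 A0 B0.
have ao0 : alpha + omega != 0 by rewrite gt_eqF// addr_gt0.
have an0 : alpha != 0 by rewrite gt_eqF.
have on0 : omega != 0 by rewrite gt_eqF.
rewrite -(lnK r0) -(lnK A0) -(lnK B0).
move: (ln r) (ln A) (ln B) => x y z /=.
rewrite -!expRN -!expRD -!expRM -!expRD -!expRN -!expRD -!expRM -!expRD.
by split; congr expR; field; rewrite ?an0 ?on0 ?ao0.
Qed.

(** * The growth estimate *)

Lemma sin_pi_int (R : realType) (k : int) : sin (pi * k%:~R) = 0 :> R.
Proof.
have sin_pi_nat n : sin (pi * n%:R) = 0 :> R.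
  elim: n => [|n ih]; first by rewrite mulr0 sin0.
  by rewrite -natr1 mulrDr mulr1 sinD ih sinpi mulr0 mul0r addr0.
case: k => n; first exact: sin_pi_nat.
by rewrite NegzE mulrNz mulrN sinN sin_pi_nat oppr0.
Qed.

Lemma sin_eq0_pi_int (R : realType) (x : R) :
  sin x = 0 -> exists k : int, x = pi * k%:~R.
Proof.
move=> sx; exists (Num.floor (x / pi)); set k := Num.floor _.
have pi0 := @pi_gt0 R.
have /andP[kx xk] := floor_itv (x / pi).
move: kx xk; rewrite -/k ler_pdivlMr// ltr_pdivrMr// intrD => kx xk.
apply/eqP; rewrite -subr_eq0; apply/negPn/negP => yn0.
have y0 : 0 < x - pi * k%:~R.
  by rewrite lt_neqAle eq_sym yn0/= subr_ge0 mulrC.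
have : 0 < sin (x - pi * k%:~R).
  apply: sin_gt0_pi; rewrite y0/=.
  by move: xk; rewrite mulrDl mul1r mulrC; lra.
by rewrite sinB sx sin_pi_int mul0r mulr0 subrr ltxx.
Qed.

Lemma ln_le_expR (R : realType) (x y : R) : 0 <= y -> x <= expR y -> ln x <= y.
Proof.
move=> y0 xy; have [x0|x0] := leP x 0; first by rewrite ln0.
by rewrite -[leRHS]expRK ler_ln// posrE expR_gt0.
Qed.

(** The polynomial factor is eventually absorbed by the exponential: apply
[1 + x <= expR (sigma * x `^ sigma^-1)] and note that [r `^ sigma^-1] is of
smaller order than [r `^ (2 / sigma)]. *)
Lemma near_affine_le_expR (R : realType) (K D sigma : R) :
  0 <= K -> 0 < D -> 1 <= sigma ->
  \forall r \near +oo, r * K + 2 <= expR (r `^ (2 / sigma) * D).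
Proof.
move=> K0 D0 s1; have s0 : 0 < sigma by rewrite (lt_le_trans ltr01).
pose E := sigma * (K + 1) `^ sigma^-1 / D.
have E0 : 0 <= E by rewrite divr_ge0 ?mulr_ge0 ?powR_ge0// ltW.
exists (Num.max 1 (E `^ sigma)); split; first exact: num_real.
move=> r; rewrite gt_max => /andP[r1 Er].
have r0 : 0 < r by rewrite (lt_trans ltr01).
have Kr0 : 0 <= r * K by rewrite mulr_ge0// ltW.
rewrite (_ : r * K + 2 = 1 + (r * K + 1)); last by ring.
apply: (le_trans (ge1Dx_expR_powR s1 _)); first by rewrite addr_ge0.
rewrite ler_expR.
have Er' : E <= r `^ sigma^-1.
  rewrite -[leLHS](powRr1 E0) -(mulfV (lt0r_neq0 s0)) powRrM.
  apply: ge0_ler_powR;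
    by rewrite ?nnegrE ?invr_ge0 ?powR_ge0 ?(ltW s0) ?(ltW r0)// ltW.
apply: (@le_trans _ _ (sigma * (((K + 1) * r) `^ sigma^-1))).
  rewrite ler_pM2l//; apply: ge0_ler_powR;
    rewrite ?nnegrE ?invr_ge0 ?(ltW s0) ?addr_ge0//.
    by rewrite mulr_ge0 ?addr_ge0// ltW.
  by rewrite mulrDl mul1r mulrC lerD2l ltW.
rewrite powRM ?addr_ge0 ?(ltW r0)// mulrA.
have -> : r `^ (2 / sigma) = r `^ sigma^-1 * r `^ sigma^-1.
  rewrite -powRD; last by rewrite (lt0r_neq0 r0) implybT.
  by rewrite -mulr2n mulr_natl.
rewrite [leRHS]mulrAC ler_wpM2r ?powR_ge0//.
by move: Er'; rewrite /E ler_pdivrMr.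
Qed.

Theorem theorem4p7 (R : realType) :
  exists2 c : R, 0 < c &
    forall (l phi : R^nat) (WH : R[i] -> 'M[R[i]]_2) (psi alpha omega : R),
      limit_circle_hamburger l phi ->
      monodromy_matrix (total_length l) (hamburger l phi) WH ->
      1 <= alpha -> 1 <= omega ->
      in_lp alpha^-1 l ->
      in_lp omega^-1 (fun j => l j * sin (phi j - psi) ^+ 2) ->
      \forall r \near +oo,
        ln (ComplexField.Normc.normc (WH (Complex 0 r) 1 1)) <=
          r `^ (2 / (alpha + omega)) *
          (c * (alpha + omega) *
           (limn (series (fun j => l j `^ alpha^-1))) `^ (alpha / (alpha + omega)) *
           (limn (series (fun j => (l j * sin (phi j - psi) ^+ 2) `^ omega^-1)))
             `^ (omega / (alpha + omega))).
Proof.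
(* One unit absorbs T + T^-1 + 2; the other two bound the factor
   2 `^ alpha^-1, respectively 2 `^ omega^-1, of the growth estimate. *)
exists 3 => // l phi WH psi alpha omega lch mono a1 o1 la lo.
have [l0 _ phi_inc] := lch.
have a0 : 0 < alpha by rewrite (lt_le_trans ltr01).
have o0 : 0 < omega by rewrite (lt_le_trans ltr01).
pose m j := l j * sin (phi j - psi) ^+ 2.
have m0 j : 0 <= m j by rewrite mulr_ge0 ?sqr_ge0// ltW.
set A := limn (series (fun j => l j `^ alpha^-1)).
set B := limn (series (fun j => m j `^ omega^-1)).
have A0 : 0 < A.
  have := @ler_sum_limn _ (fun j => l j `^ alpha^-1) 1 (fun j => powR_ge0 _ _)
    (in_lp_cvgn (fun j => ltW (l0 j)) la).
  by rewrite big_ord1; apply: lt_le_trans; exact: powR_gt0.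
(* Two consecutive angles cannot both agree with psi modulo pi. *)
have B0 : 0 < B.
  have := @ler_sum_limn _ (fun j => m j `^ omega^-1) 2 (fun j => powR_ge0 _ _)
    (in_lp_cvgn m0 lo).
  rewrite big_ord_recr big_ord1 /=; apply: lt_le_trans.
  rewrite lt_neqAle addr_ge0 ?powR_ge0// andbT eq_sym paddr_eq0 ?powR_ge0//.
  apply/negP => /andP[/eqP/powR_eq0_eq0/eqP + /eqP/powR_eq0_eq0/eqP].
  rewrite !mulf_eq0 !(gt_eqF (l0 _)) /= !orbb => /eqP s0 /eqP s1.
  have [k phik] : exists k : int, phi 1%N - phi 0%N = pi * k%:~R.
    apply: sin_eq0_pi_int.
    have -> : phi 1%N - phi 0%N = (phi 1%N - psi) - (phi 0%N - psi) by ring.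
    by rewrite sinB s0 s1 mul0r mulr0 subrr.
  exact: (phi_inc 0%N k).
set sigma := alpha + omega.
have s2 : 1 <= sigma by rewrite /sigma; lra.
have s0 : 0 < sigma by rewrite (lt_le_trans ltr01).
pose P := A `^ (alpha / sigma) * B `^ (omega / sigma).
have P0 : 0 < P by rewrite mulr_gt0 ?powR_gt0.
pose K := (A / B) `^ (alpha * omega / sigma).
have K0 : 0 < K by apply: powR_gt0; exact: divr_gt0.
have KK0 : 0 <= K + K^-1 by rewrite addr_ge0 ?invr_ge0 ?ltW.
have [M [Mreal hM]] := near_affine_le_expR KK0 (mulr_gt0 s0 P0) s2.
exists (Num.max 1 M); split; first exact: num_real.
move=> r; rewrite gt_max => /andP[r1 Mr].
have r0 : 0 < r by rewrite (lt_trans ltr01).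
have {hM} hM := hM r Mr.
have [W fW ->] := mono (Complex 0 r).
have [balA balB] := powR_balance a0 o0 r0 A0 B0.
set T := r `^ _ * _ in balA balB; rewrite -/sigma -/P in balA balB.
have T0 : 0 < T by rewrite mulr_gt0 ?powR_gt0 ?divr_gt0.
have hW := normc_w22_le lch a1 o1 la lo (ltW r0) T0 fW.
rewrite -/A -/B in hW.
set Q := r `^ (2 / sigma) * P in balA balB.
have Q0 : 0 <= Q by rewrite mulr_ge0 ?powR_ge0// ltW.
rewrite -(mulrA (3 * sigma)) -/P mulrCA -/Q.
apply: ln_le_expR; first by rewrite mulr_ge0// mulr_ge0 ?ltW.
apply: (le_trans hW).
have splitQ (x p t : R) : 3 * t * (x * p) = x * (t * p) + 2 * t * (x * p).
  by ring.
rewrite [X in _ <= expR X]splitQ -/Q.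
rewrite [leRHS]expRD; apply: ler_pM; rewrite ?expR_ge0//.
- by rewrite !addr_ge0 ?invr_ge0 ?ltW.
- apply: le_trans hM; rewrite lerD2r mulrDr.
  have e1 : (omega - alpha) / sigma <= 1.
    by rewrite ler_pdivrMr// mul1r /sigma; lra.
  have e2 : - ((omega - alpha) / sigma) <= 1.
    by rewrite -mulNr ler_pdivrMr// mul1r /sigma; lra.
  apply: lerD; first by rewrite ler_pM2r// ler1_powR// ltW.
  rewrite /T invfM -powRN ler_pM2r ?invr_gt0//.
  by rewrite ler1_powR// ltW.
have sumQ (x : R) : 2 * sigma * x = alpha * (2 * x) + omega * (2 * x).
  by rewrite /sigma; ring.
rewrite ler_expR sumQ.
have two_powR e x : 1 <= e -> 0 <= x -> (2 * x) `^ e^-1 <= 2 * x `^ e^-1.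
  move=> e1 x0; rewrite powRM// ler_wpM2r ?powR_ge0//.
  by rewrite ler1_powR// ?invf_le1 ?(lt_le_trans ltr01)// ler1n.
apply: lerD; rewrite -mulrA ler_pM2l//.
  rewrite -balA [leRHS]mulrA; apply: ler_wpM2r; first exact: ltW.
  by rewrite -mulrA two_powR// divr_ge0 ?ltW.
rewrite -balB [leRHS]mulrA; apply: ler_wpM2r; first exact: ltW.
by rewrite -mulrA two_powR// mulr_ge0 ?ltW.
Qed.
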